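(* Let $n\ge 2$, let $G=\{g_1,\ldots,g_v\}$ be a group of order $v$, and let $\mathcal{D}=\{B_1,\ldots,B_v\}$ be a symmetric $(v,k,\lambda)$ design with point set $G$ such that every block $B_i$ is a $(v,k,\lambda)$ difference set in $G$. Then the function $C:\{1,\ldots,v\}^n\to\{0,1\}$ given by $C(i_1,\ldots,i_n)=[g_{i_2}\cdots g_{i_n}\in B_{i_1}]$ is an $n$-dimensional cube of $(v,k,\lambda)$ designs, i.e. every slice of $C$ is an incidence matrix of a symmetric $(v,k,\lambda)$ design.
   Context: A symmetric $(v,k,\lambda)$ design on a $v$-set $V$ is a collection of $v$ $k$-subsets (blocks) of $V$ such that every pair of distinct points lies in exactly $\lambda$ blocks; its incidence matrix for orderings $p_1,\ldots,p_v$ of points and $B_1,\ldots,B_v$ of blocks is $a_{ij}=[p_i\in B_j]$, where $[P]$ is $1$ if $P$ holds and $0$ otherwise. A $(v,k,\lambda)$ difference set in $G$ is a $k$-subset $D\subseteq G$ such that every non-identity $g\in G$ equals $d_1^{-1}d_2$ for exactly $\lambda$ pairs $(d_1,d_2)\in D\times D$. For an $n$-cube $C:\{1,\ldots,v\}^n\to\{0,1\}$, distinct positions $x,y\in\{1,\ldots,n\}$ and fixed values of the other $n-2$ coordinates, the slice is the $v\times v$ matrix obtained by letting the coordinates in positions $x$ (rows) and $y$ (columns) vary over $\{1,\ldots,v\}$. *)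

(* Defs.v *)
From mathcomp Require Import all_boot all_algebra all_fingroup.

Set Implicit Arguments.
Unset Strict Implicit.
Unset Printing Implicit Defensive.

Local Open Scope group_scope.

Definition ordering (T : finType) (v : nat) (A : {set T}) (f : 'I_v -> T) :
  Prop := injective f /\ f @: [set: 'I_v] = A.

Definition symmetric_design (V : finType) (v k lam : nat)
    (D : {set {set V}}) : Prop :=
  [/\ #|V| = v,
      #|D| = v,
      forall B, B \in D -> #|B| = k
    & forall p q : V, p != q ->
        #|[set B in D | (p \in B) && (q \in B)]| = lam].

Definition difference_set (G : finGroupType) (v k lam : nat) (D : {set G}) :
  Prop :=
  [/\ #|G| = v,
      #|D| = k
    & forall g : G, g != 1 ->
        #|[set d in setX D D | d.1^-1 * d.2 == g]| = lam].

(* The values 0 and 1 are represented by the booleans, so that the Iverson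
   bracket [P] is the boolean P itself. *)
Definition incidence_matrix (V : finType) (v : nat) (p : 'I_v -> V)
    (B : 'I_v -> {set V}) : 'M[bool]_v :=
  \matrix_(i, j) (p i \in B j).

Definition is_incidence_matrix (V : finType) (v : nat) (D : {set {set V}})
    (A : 'M[bool]_v) : Prop :=
  exists (p : 'I_v -> V) (B : 'I_v -> {set V}),
    [/\ ordering [set: V] p, ordering D B & A = incidence_matrix p B].

Definition cube (v n : nat) : Type := {ffun 'I_n -> 'I_v} -> bool.

(* The fixed values of the other n - 2 coordinates are given by a full index
   vector c, whose entries in positions x and y are ignored. *)
Definition slice (v n : nat) (C : cube v n) (x y : 'I_n)
    (c : {ffun 'I_n -> 'I_v}) : 'M[bool]_v :=
  \matrix_(i, j) C [ffun z => if z == x then i else if z == y then j else c z].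

Definition cube_of_designs (v k lam n : nat) (C : cube v n) : Prop :=
  forall (x y : 'I_n) (c : {ffun 'I_n -> 'I_v}), x != y ->
    exists (V : finType) (D : {set {set V}}),
      symmetric_design v k lam D /\ is_incidence_matrix D (slice C x y c).

(* Positions are numbered from 0, so i_1 is the entry in position 0 and
   g_{i_2} ... g_{i_n} is the product over the positive positions, taken in
   increasing order. *)
Definition group_cube (G : finGroupType) (v n : nat) (n_gt1 : 1 < n)
    (g : 'I_v -> G) (B : 'I_v -> {set G}) : cube v n :=
  fun i => \prod_(z < n | 0 < z) g (i z) \in B (i (Ordinal (ltnW n_gt1))).

(* Main.v *)
(* A v x v 0/1 matrix N with row and column sums k and row inner products lam
   satisfies N (N^T - (lam / k) J) = (k - lam) I.  As a one-sided inverse of a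
   square matrix is two-sided, N^T has constant row inner products too.  A slice
   in a direction other than the first one is, up to translations, the
   multiplication table of G tested against one difference set; a slice involving
   the first direction is, up to translation, the incidence matrix of the given
   design.  In each case the rows or the columns have constant inner products,
   and the duality above makes the other half automatic. *)
Require Import Defs.
From mathcomp Require Import all_boot all_algebra all_fingroup.

Set Implicit Arguments.
Unset Strict Implicit.
Unset Printing Implicit Defensive.

Import GRing.Theory.

(** * Counting and transposition for 0/1 matrices *)

(** Inner products are constrained for rows only, the half that can be checked directly on a slice
    or its transpose; [design_mx_tr] supplies the half for columns. *)
Definition design_mx (v k lam : nat) (A : 'M[bool]_v) : Prop :=
  [/\ forall i, #|[set j | A i j]| = k,
      forall j, #|[set i | A i j]| = k
    & forall i i', i != i' -> #|[set j | A i j && A i' j]| = lam].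

Lemma card_setE (T : finType) (P : pred T) : #|[set x | P x]| = \sum_x P x.
Proof. by rewrite -sum1dep_card big_mkcond; apply: eq_bigr => x _; case: (P x). Qed.

Lemma ord_le1_eq (v : nat) (i j : 'I_v) : v <= 1 -> i = j.
Proof.
by case: v i j => [[]//|[|//]] i j _; rewrite [i]ord1 [j]ord1.
Qed.

(** Double counting of the pairs [(i', j)] with ones at both [(i, j)] and [(i', j)]; the case
    [i' = i] gives the separate summand. *)
Lemma card_row_mul (v k lam : nat) (A : 'M[bool]_v) (i : 'I_v) :
  (forall j, #|[set i' | A i' j]| = k) ->
  (forall i', i != i' -> #|[set j | A i j && A i' j]| = lam) ->
  #|[set j | A i j]| * k = #|[set j | A i j]| + v.-1 * lam.
Proof.
move=> colA rowA.
have -> : #|[set j | A i j]| * k = \sum_i' #|[set j | A i j && A i' j]|.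
  rewrite (eq_bigr (fun i' => \sum_j (A i j && A i' j : nat))); last first.
    by move=> i' _; rewrite card_setE.
  rewrite exchange_big card_setE big_distrl; apply: eq_bigr => j _ /=.
  rewrite -(colA j) card_setE big_distrr; apply: eq_bigr => i' _ /=.
  by rewrite mulnb.
rewrite (bigD1 i) //=; congr (_ + _).
  by apply: eq_card => j; rewrite !inE andbb.
rewrite (eq_bigr (fun=> lam)) => [|i' ii']; last by rewrite rowA // eq_sym.
by rewrite sum_nat_const cardC1 card_ord.
Qed.

Lemma design_mx_tr (v k lam : nat) (A : 'M[bool]_v) :
  (1 < v -> lam < k) -> design_mx k lam A -> design_mx k lam A^T.
Proof.
move=> lt_lam [rowA colA innA]; split=> [j|i|j j' jj'].
- by rewrite -(colA j); apply: eq_card => i; rewrite !inE mxE.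
- by rewrite -(rowA i); apply: eq_card => j; rewrite !inE mxE.
(* For [v <= 1] there are no two distinct columns. Otherwise [lam < k] makes both [k] and [k - lam]
   nonzero in [rat]. *)
have [v_le1|v_gt1] := leqP v 1.
  by rewrite (ord_le1_eq j j' v_le1) eqxx in jj'.
have {}lt_lam := lt_lam v_gt1.
pose N : 'M[rat]_v := (\matrix_(i, j) (A i j : nat)%:R)%R.
pose J : 'M[rat]_v := const_mx 1%R.
pose a : rat := (k%:R - lam%:R)%R.
pose c : rat := (lam%:R / k%:R)%R.
have k_neq0 : (k%:R != 0 :> rat)%R.
  by rewrite Num.Theory.pnatr_eq0 -lt0n (leq_ltn_trans _ lt_lam).
have a_neq0 : (a != 0)%R.
  by rewrite subr_eq0 Num.Theory.eqr_nat gtn_eqF.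
have NJ : (N *m J = k%:R *: J)%R.
  apply/matrixP=> i l; rewrite !mxE mulr1 -(rowA i) card_setE natr_sum.
  by apply: eq_bigr => m _; rewrite !mxE mulr1.
have JN : (J *m N = k%:R *: J)%R.
  apply/matrixP=> i l; rewrite !mxE mulr1 -(colA l) card_setE natr_sum.
  by apply: eq_bigr => m _; rewrite !mxE mul1r.
have NNT : (N *m N^T = a%:M + lam%:R *: J)%R.
  apply/matrixP=> i l; rewrite !mxE mulr1.
  have -> : (\sum_m N i m * N^T m l = #|[set m | A i m && A l m]|%:R)%R.
    rewrite card_setE natr_sum; apply: eq_bigr => m _.
    by rewrite !mxE -natrM mulnb.
  have [<-|/innA->] := eqVneq i l; last by rewrite mulr0n add0r.
  rewrite mulr1n subrK -(rowA i); congr (_%:R)%R.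
  by apply: eq_card => m; rewrite !inE andbb.
(* As [N *m J] is [k] times [J], the correction [c *: J] cancels exactly the [J] term of
   [N *m N^T]. *)
have inv : (N *m (a^-1 *: (N^T - c *: J)) = 1%:M)%R.
  rewrite -scalemxAr mulmxBr -scalemxAr NJ NNT scalerA divfK // addrK.
  by rewrite scale_scalar_mx mulVf.
(* Multiplying the two inverses in the other order brings in [JN], that is, the constant column
   sums. *)
have NTN : (N^T *m N = a%:M + lam%:R *: J)%R.
  move/mulmx1C: inv; rewrite -scalemxAl mulmxBl -scalemxAl JN scalerA divfK //.
  move/(congr1 (fun M => a *: M)%R); rewrite scalerA divff // scale1r.
  by rewrite scale_scalar_mx mulr1 => <-; rewrite subrK.
move/matrixP/(_ j j'): NTN; rewrite !mxE (negPf jj') mulr0n add0r mulr1.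
have -> : (\sum_m N^T j m * N m j' = #|[set m | A^T j m && A^T j' m]|%:R)%R.
  rewrite card_setE natr_sum; apply: eq_bigr => m _.
  by rewrite !mxE -natrM mulnb.
by move/eqP; rewrite Num.Theory.eqr_nat => /eqP.
Qed.

(** Points are the row indices, blocks the supports of the columns. Blocks form a set, so the
    supports must differ: equal columns would have inner product [k], not [lam]. *)
Lemma design_mx_incidence (v k lam : nat) (A : 'M[bool]_v) :
  (1 < v -> lam < k) -> design_mx k lam A ->
  exists (V : finType) (D : {set {set V}}),
    symmetric_design v k lam D /\ is_incidence_matrix D A.
Proof.
move=> lt_lam dA; have [_ colA innA] := dA.
have [rowT _ innT] := design_mx_tr lt_lam dA.
pose B (j : 'I_v) := [set i | A i j].
have B_inj : injective B.
  move=> j j' eqB; have [v_le1|v_gt1] := leqP v 1; first exact: ord_le1_eq.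
  apply/eqP/negPn/negP => /innT eq_lam.
  have := lt_lam v_gt1; rewrite -eq_lam -(rowT j) ltnNge subset_leq_card //.
  apply/subsetP=> i; rewrite !inE !mxE => Aij; rewrite Aij /=.
  by move/setP/(_ i): eqB; rewrite !inE Aij => <-.
exists 'I_v, (B @: [set: 'I_v]); split; first split.
- by rewrite card_ord.
- by rewrite card_imset // cardsT card_ord.
- by move=> _ /imsetP[j _ ->]; apply: colA.
- move=> p q /innA <-; rewrite -(card_imset _ B_inj); apply: eq_card => X.
  rewrite inE; apply/andP/imsetP => [[/imsetP[j _ ->] pq]|[j pq ->]].
    by exists j => //; move: pq; rewrite !inE.
  by move: pq; rewrite imset_f ?inE.
exists id, B; split; first by split=> //; rewrite imset_id.
  by split.
by apply/matrixP=> i j; rewrite !mxE inE.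
Qed.

(** * Ordered group products with one or two varying factors *)

Section IsolateFactors.

Local Open Scope group_scope.

Variables (G : finGroupType) (I : eqType) (P : pred I).
Implicit Types (x y : I) (s : seq I) (F : I -> G).

Lemma prod_cat_cons_if s1 s2 x F t : uniq (s1 ++ x :: s2) -> P x ->
  \prod_(z <- s1 ++ x :: s2 | P z) (if z == x then t else F z) =
  \prod_(z <- s1 | P z) F z * t * \prod_(z <- s2 | P z) F z.
Proof.
rewrite cat_uniq /= negb_or => /and3P[_ /andP[xs1 _] /andP[xs2 _]] Px.
rewrite big_cat big_cons Px eqxx /= mulgA; congr (_ * _ * _).
  rewrite big_seq_cond [RHS]big_seq_cond; apply: eq_bigr => z /andP[zs _].
  by rewrite (negPf (memPn xs1 z zs)).
rewrite big_seq_cond [RHS]big_seq_cond; apply: eq_bigr => z /andP[zs _].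
by rewrite (negPf (memPn xs2 z zs)).
Qed.

Lemma prod_isolate1 s x F : uniq s -> x \in s -> P x ->
  exists a b : G, forall t,
    \prod_(z <- s | P z) (if z == x then t else F z) = a * t * b.
Proof.
move=> + xs Px; case/splitPr: xs => s1 s2 s_uniq.
exists (\prod_(z <- s1 | P z) F z), (\prod_(z <- s2 | P z) F z) => t.
exact: prod_cat_cons_if.
Qed.

(** Factors need not commute, so the two alternatives record which of [x] and [y] comes first in
    [s]. *)
Lemma prod_isolate2 s x y F
    (p := fun t u : G => \prod_(z <- s | P z)
            (if z == x then t else if z == y then u else F z)) :
  uniq s -> x \in s -> y \in s -> x != y -> P x -> P y ->
  exists a b c : G, (forall t u, p t u = a * t * b * u * c) \/
                    (forall t u, p t u = a * u * b * t * c).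
Proof.
rewrite /p => {p} + xs + xy Px Py; case/splitPr: xs => s1 s2 s_uniq.
rewrite mem_cat inE eq_sym (negPf xy) /= => ys.
have Q_const s' u : y \notin s' ->
    \prod_(z <- s' | P z) (if z == y then u else F z) =
    \prod_(z <- s' | P z) F z.
  move=> ys'; rewrite big_seq_cond [RHS]big_seq_cond.
  by apply: eq_bigr => z /andP[zs _]; rewrite (negPf (memPn ys' z zs)).
have := s_uniq; rewrite cat_uniq /= negb_or.
move=> /and3P[u1 /andP[_ /hasPn s12] /andP[_ u2]].
have [ys1|ys1] := boolP (y \in s1).
  have ys2 : y \notin s2 by apply: contraL ys1 => /s12.
  have [a [b Qab]] := prod_isolate1 F u1 ys1 Py.
  exists a, b, (\prod_(z <- s2 | P z) F z); right=> t u.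
  by rewrite prod_cat_cons_if // (Q_const s2) // Qab.
have ys2 : y \in s2 by rewrite (negPf ys1) in ys.
have [a [b Qab]] := prod_isolate1 F u2 ys2 Py.
exists (\prod_(z <- s1 | P z) F z), a, b; left=> t u.
by rewrite prod_cat_cons_if // (Q_const s1) // Qab !mulgA.
Qed.

End IsolateFactors.

(** * Matrices of difference sets *)

Lemma card_preim_inj (T : finType) (v : nat) (f : 'I_v -> T) (A : {set T}) :
  #|T| = v -> injective f -> #|[set i | f i \in A]| = #|A|.
Proof.
move=> oT f_inj; have /inj_card_onto f_onto := f_inj.
rewrite -(card_imset _ f_inj); apply: eq_card => x.
apply/imsetP/idP => [[i + ->]|xA]; first by rewrite inE.
have /codomP[i xE] := f_onto (eq_leq (etrans oT (esym (card_ord v)))) x.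
by exists i; rewrite ?inE -?xE.
Qed.

Section DifferenceSet.

Local Open Scope group_scope.

Variables (G : finGroupType) (v k lam : nat) (D : {set G}).
Hypothesis D_diff : difference_set v k lam D.

(** In the quotient [d1^-1 * d2] of [d1 = x * f i] and [d2 = x * f i'] the left factor [x] cancels.
    So the elements [x = h j] counted by two rows correspond to the pairs in [D] with quotient
    [(f i)^-1 * f i']. *)
Lemma difference_set_design_mx (f h : 'I_v -> G) :
  injective f -> injective h ->
  design_mx k lam (\matrix_(i, j) (h j * f i \in D)%g).
Proof.
move=> f_inj h_inj; set M := (X in design_mx _ _ X).
have [oG oD diffD] := D_diff; split=> [i|j|i i' ii'].
- rewrite -oD -(@card_preim_inj _ _ (fun j => h j * f i) D oG).
    by apply: eq_card => j; rewrite !inE mxE.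
  by move=> j j' /mulIg/h_inj.
- rewrite -oD -(@card_preim_inj _ _ (fun i => h j * f i) D oG).
    by apply: eq_card => i; rewrite !inE mxE.
  by move=> i i' /mulgI/f_inj.
have fii' : (f i)^-1 * f i' != 1.
  by rewrite -eq_mulVg1 (inj_eq f_inj).
rewrite -(diffD _ fii').
pose E := [set x | (x * f i \in D) && (x * f i' \in D)].
have -> : #|[set j | M i j && M i' j]| = #|E|.
  rewrite -(card_preim_inj E oG h_inj).
  by apply: eq_card => j; rewrite !inE !mxE.
have E_inj : injective (fun x => (x * f i, x * f i')) by move=> x x' [/mulIg].
rewrite -(card_imset E E_inj); apply: eq_card => -[d1 d2]; rewrite !inE /=.
apply/imsetP/andP => [[x xE [-> ->]]|[/andP[D1 D2] /eqP d12]].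
  by move: xE; rewrite inE => ->; rewrite invMg mulgA mulgKV.
have d2E : d1 * (f i)^-1 * f i' = d2 by rewrite -mulgA -d12 mulKVg.
by exists (d1 * (f i)^-1); rewrite ?inE d2E mulgKV ?D1.
Qed.

End DifferenceSet.

(** * Incidence matrices of the given design *)

Section Design.

Variables (G : finType) (v k lam : nat) (D : {set {set G}}).
Hypothesis D_design : symmetric_design v k lam D.
Variable B : 'I_v -> {set G}.
Hypothesis B_ord : ordering D B.

Lemma ordering_mem i : B i \in D.
Proof. by have [_ <-] := B_ord; rewrite imset_f. Qed.

(** At the excluded values of [k] all blocks would be empty or all would be the whole point set,
    although at least two blocks are distinct. *)
Lemma symmetric_design_k_bounds : 1 < v -> 0 < k < v.
Proof.
move=> v_gt1; have [oG _ oB _] := D_design; have [B_inj _] := B_ord.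
have B01 : B (Ordinal (ltnW v_gt1)) != B (Ordinal v_gt1) by rewrite (inj_eq B_inj).
have cB i : #|B i| = k by rewrite oB ?ordering_mem.
rewrite lt0n; apply/andP; split.
  apply: contraNneq B01 => k0.
  have B0 i : B i = set0 by apply: cards0_eq; rewrite cB.
  by rewrite !B0.
rewrite ltnNge; apply: contraNN B01 => v_le_k.
have BT i : B i = setT.
  by apply/eqP; rewrite eqEcard subsetT cB cardsT oG.
by rewrite !BT.
Qed.

(* For k > 1 the counting identity determines the row sums; for k = 1 it is
   void, but then the v distinct blocks are all the singletons. *)
Lemma symmetric_design_mx (f : 'I_v -> G) :
  (1 < v -> k * k = k + v.-1 * lam) -> injective f ->
  design_mx k lam (\matrix_(i, j) (f i \in B j)).
Proof.
move=> kk f_inj; have [oG oD oB innD] := D_design; have [B_inj DE] := B_ord.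
have cB j : #|B j| = k by rewrite oB ?ordering_mem.
set A := (X in design_mx _ _ X).
have colA j : #|[set i | A i j]| = k.
  rewrite -(cB j) -(card_preim_inj (B j) oG f_inj).
  by apply: eq_card => i; rewrite !inE mxE.
have innA i i' : i != i' -> #|[set j | A i j && A i' j]| = lam.
  move=> ii'; have fii' : f i != f i' by rewrite (inj_eq f_inj).
  rewrite -(innD _ _ fii') -(card_imset _ B_inj); apply: eq_card => X.
  rewrite [in RHS]inE -DE; apply/imsetP/andP => [[j + ->]|[/imsetP[j _ ->] ffX]].
    by rewrite inE !mxE imset_f.
  by exists j; rewrite // inE !mxE.
split=> // i.
have [v_le1|v_gt1] := leqP v 1.
  rewrite -(colA i); apply: eq_card => j.
  by rewrite !inE (ord_le1_eq i j).
have /andP[k_gt0 _] := symmetric_design_k_bounds v_gt1.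
have := card_row_mul colA (innA i); have {}kk := kk v_gt1.
set r := #|_|.
have [k_gt1|k_le1] := ltnP 1 k.
  move=> rk; have k1_gt0 : 0 < k.-1 by rewrite -ltnS prednK.
  apply/eqP; rewrite -(eqn_pmul2r k1_gt0) -subn1 !mulnBr !muln1.
  by rewrite rk kk !addKn.
have k1 : k = 1%N by apply/eqP; rewrite eqn_leq k_le1.
rewrite {}/r => _.
have DS : D = [set [set x] | x : G].
  apply/eqP; rewrite eqEcard card_imset ?oG ?oD ?leqnn ?andbT; last exact: set1_inj.
  apply/subsetP=> X /oB; rewrite k1 => /eqP/cards1P[x ->]; exact: imset_f.
have : [set f i] \in D by rewrite DS imset_f.
rewrite -DE => /imsetP[j _ jE].
rewrite k1 -(cards1 j); apply: eq_card => j'; rewrite !inE mxE.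
apply/idP/eqP => [fi|->]; last by rewrite -jE set11.
apply: B_inj; rewrite -jE; apply/esym/eqP.
by rewrite eqEcard sub1set fi cB k1 cards1.
Qed.

End Design.

(** * Slices of the group cube *)

Theorem theorem4p1 (n v k lam : nat) (n_gt1 : 1 < n)
    (G : finGroupType) (oG : #|G| = v)
    (g : 'I_v -> G) (g_ord : ordering [set: G] g)
    (D : {set {set G}}) (D_design : symmetric_design v k lam D)
    (B : 'I_v -> {set G}) (B_ord : ordering D B)
    (B_diff : forall i : 'I_v, difference_set v k lam (B i)) :
  cube_of_designs k lam (group_cube n_gt1 g B).
Proof.
have [g_inj _] := g_ord.
(* The multiplication table tested against a single block already has row sums [k], so
   [card_row_mul] yields the identity. *)
have kk : 1 < v -> k * k = k + v.-1 * lam.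
  move=> v_gt1; pose i0 := Ordinal v_gt1.
  have [rowM colM innM] := difference_set_design_mx (B_diff i0) g_inj g_inj.
  by have := card_row_mul colM (innM i0); rewrite rowM.
(* If [k <= lam], then [k <= v.-1] gives [k * k <= v.-1 * lam], which contradicts [kk] because [k]
   is positive. *)
have lt_lam : 1 < v -> lam < k.
  move=> v_gt1; have /andP[k_gt0 k_lt] := symmetric_design_k_bounds D_design B_ord v_gt1.
  have k_le : k <= v.-1 by rewrite -ltnS prednK // ltnW.
  rewrite ltnNge; apply/negP => k_le_lam.
  have := leq_mul k_le k_le_lam; rewrite kk // -[leqRHS]add0n leq_add2r.
  by rewrite leqNgt k_gt0.
suff slice_mx x y c : x != y -> design_mx k lam (slice (group_cube n_gt1 g B) x y c).
  by move=> x y c xy; apply: design_mx_incidence (slice_mx x y c xy).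
pose o : 'I_n := Ordinal (ltnW n_gt1).
have slice_tr a b : a != b ->
    slice (group_cube n_gt1 g B) a b c = (slice (group_cube n_gt1 g B) b a c)^T%R.
  move=> ab; apply/matrixP=> i j; rewrite !mxE; congr (group_cube _ _ _ _).
  apply/ffunP=> z; rewrite !ffunE.
  by have [->|//] := eqVneq z a; rewrite (negPf ab).
(* Position [o] selects the block, so columns run through all blocks, while rows run through the
   translates [p * g i * q] of the points. *)
have slice_o a : a != o -> design_mx k lam (slice (group_cube n_gt1 g B) a o c).
  move=> ao.
  have a_gt0 : 0 < a by rewrite lt0n.
  have [p [q pqE]] := prod_isolate1 (P := fun z : 'I_n => 0 < z)
    (fun z => g (c z)) (index_enum_uniq _) (mem_index_enum a) a_gt0.
  have -> : slice (group_cube n_gt1 g B) a o c =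
      (\matrix_(i, j) (p * g i * q \in B j)%g)%R.
    apply/matrixP=> i j; rewrite !mxE /group_cube !ffunE -/o eq_sym (negPf ao) eqxx.
    rewrite -pqE; congr (in_mem _ _); apply: eq_bigr => z z_gt0; rewrite !ffunE.
    have zo : z != o by rewrite -(inj_eq val_inj) -lt0n.
    by rewrite (negPf zo); case: ifP.
  apply: (symmetric_design_mx D_design B_ord kk) => i i'.
  by move/mulIg/mulgI/g_inj.
move=> xy.
have [yo|yo] := eqVneq y o.
  by rewrite yo; apply: slice_o; rewrite -yo.
have [xo|xo] := eqVneq x o.
  by rewrite slice_tr // xo; exact: (design_mx_tr lt_lam (slice_o _ yo)).
(* Neither direction is [o], so the block is fixed at [B (c o)]. *)
have x_gt0 : 0 < x by rewrite lt0n.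
have y_gt0 : 0 < y by rewrite lt0n.
have [p [q [r pqrE]]] := prod_isolate2 (P := fun z : 'I_n => 0 < z)
  (fun z => g (c z)) (index_enum_uniq _) (mem_index_enum x) (mem_index_enum y)
  xy x_gt0 y_gt0.
have sliceE i j : slice (group_cube n_gt1 g B) x y c i j =
    ((\prod_(z < n | 0 < z)
       (if z == x then g i else if z == y then g j else g (c z)))%g \in B (c o)).
  rewrite mxE /group_cube ffunE -/o eq_sym (negPf xo) eq_sym (negPf yo).
  congr (in_mem _ _); apply: eq_bigr => z _; rewrite ffunE.
  by case: ifP => // _; case: ifP.
have pg_inj : injective (fun i => p * g i * q)%g by move=> i i' /mulIg/mulgI/g_inj.
have gr_inj : injective (fun i => g i * r)%g by move=> i i' /mulIg/g_inj.
have dM := difference_set_design_mx (B_diff (c o)) gr_inj pg_inj.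
(* In [dM] the row index sits in the right factor. If position [x] comes first in the product, the
   slice is the transpose of that matrix; otherwise it is that matrix itself. *)
case: pqrE => pqrE.
  suff -> : slice (group_cube n_gt1 g B) x y c =
      (\matrix_(i, j) (p * g j * q * (g i * r) \in B (c o))%g)^T%R.
    exact: design_mx_tr.
  by apply/matrixP=> i j; rewrite sliceE pqrE !mxE !mulgA.
suff -> : slice (group_cube n_gt1 g B) x y c =
    (\matrix_(i, j) (p * g j * q * (g i * r) \in B (c o))%g)%R by [].
by apply/matrixP=> i j; rewrite sliceE pqrE !mxE !mulgA.
Qed.
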